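(* For every integer $k\ge1$ there is a function $\lambda:(0,2]\to\mathbb{R}$ which is continuous and satisfies $|\lambda|\le 6k$, such that the covariance $G$ of the $k$-coarse MBRW satisfies $$G(x,y)=\log\frac{1}{|x-y|}+\lambda(|x-y|)$$ for all $x,y\in\mathbb{T}$ with $0<|x-y|\le2$.
   Context: $\mathbb{T}=\mathbb{R}^2/(4\mathbb{Z})^2$ is the torus with the natural metric $|x-y|$ inherited from Euclidean distance; $B(z,R)$ is the open ball of center $z$ and radius $R$; $|\cdot|$ of a set is Lebesgue measure; $A(x,y;R)=|B(x,R)\cap B(y,R)|/|B(x,R)|$. The $k$-coarse MBRW is the centered Gaussian field on $\mathbb{T}$ with covariance $G(x,y)=k\log2\sum_{j=0}^\infty A(x,y;2^{-kj})$. *)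

(* Defs.v *)
From HB Require Import structures.
From mathcomp Require Import all_boot all_order all_algebra.
From mathcomp Require Import all_classical all_reals all_analysis.
Import Order.TTheory GRing.Theory Num.Theory.
Import numFieldNormedType.Exports.

Set Implicit Arguments.
Unset Strict Implicit.
Unset Printing Implicit Defensive.

Local Open Scope classical_set_scope.
Local Open Scope ring_scope.

Section Torus.
Variable R : realType.

Definition lattice4 : {pred R * R} :=
  [pred p : R * R | (p.1 / 4 \is a Num.int) && (p.2 / 4 \is a Num.int)].

Lemma lattice_zmod_closed : zmod_closed lattice4.
Proof.
split=> [|p q /andP[p1 p2] /andP[q1 q2]].
  by apply/andP; rewrite /= !mul0r !rpred0.
by apply/andP; rewrite /= !mulrBl !rpredB.
Qed.

HB.instance Definition _ :=
  GRing.isZmodClosed.Build (R * R)%type lattice4 lattice_zmod_closed.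

Definition torus : Type := {ideal_quot lattice4}.

Definition torus_proj (p : R * R) : torus := \pi_{ideal_quot lattice4}%qT p.

(* The library norm on R * R is the sup norm, hence this definition. *)
Definition enorm (p : R * R) : R := Num.sqrt (p.1 ^+ 2 + p.2 ^+ 2).

(* The least Euclidean distance between representatives. *)
Definition torus_dist (x y : torus) : R :=
  inf [set enorm (p - q) | p in torus_proj @^-1` [set x] & q in torus_proj @^-1` [set y]].

Definition torus_ball (z : torus) (r : R) : set torus := [set w | torus_dist z w < r].

(* Lebesgue measure on the torus, through the fundamental domain [0, 4)^2. *)
Definition torus_area (E : set torus) : \bar R :=
  (lebesgue_measure \x lebesgue_measure)%E
    (torus_proj @^-1` E `&` (`[0, 4[ `*` `[0, 4[)).

Definition overlap (x y : torus) (r : R) : R :=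
  fine (torus_area (torus_ball x r `&` torus_ball y r)) / fine (torus_area (torus_ball x r)).

(* The series has nonnegative terms; it diverges when x = y, so it is summed
   in the extended reals. *)
Definition covMBRW (k : nat) (x y : torus) : \bar R :=
  ((k%:R * ln 2)%:E * \sum_(0 <= j <oo) (overlap x y (2 ^- (k * j)))%:E)%E.

End Torus.

(* Main.v *)
Require Import Defs.
From HB Require Import structures.
From mathcomp Require Import all_boot all_order all_algebra.
From mathcomp Require Import all_classical all_reals all_analysis.
From mathcomp Require Import measurable_realfun ring lra.
Import Order.TTheory GRing.Theory Num.Theory.
Import numFieldNormedType.Exports.

(**
Write L(d, r) for the area of the intersection of two plane discs of radius r
whose centers are at distance d.  It is well defined because rotations are
products of shears, and shears preserve area by Fubini and the translation
invariance of length.  For r <= 1 the discs embed in the torus without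
wrapping around, so the overlap at scale r is A(d, r) = L(d, r) / L(0, r).

Horizontal sections show that L is 2r-Lipschitz in d; hence A is continuous
in d and, as L(0, r) >= 48/25 r^2, one has 1 - 25/24 d/r <= A(d, r) <= 1.
Also A(d, r) = 0 for d >= 2r.  With r = 2^(-kj) the series thus has n nonzero
terms, where n is minimal with d 2^(kn) >= 2, and up to a geometric error of
at most 25/6 they sum to n, so that G is close to k n log 2, which is
log (1/d) up to (k + 1) log 2.
*)

Local Open Scope classical_set_scope.
Local Open Scope ring_scope.

(** * Plane area: invariance under shears, translations and rotations *)

Section PlaneMeasure.
Variable R : realType.
Local Notation mu := (@lebesgue_measure R).
Local Notation area := ((@lebesgue_measure R \x @lebesgue_measure R)%E).
Implicit Types (A : set R) (E : set (R * R)).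

(** By uniqueness of Lebesgue measure: its pushforward under a translation still gives every
    half-open interval its length. *)
Lemma lebesgue_measure_translate (a : R) A : measurable A ->
  mu ((fun x => x + a) @^-1` A) = mu A.
Proof.
move=> mA.
have mf : measurable_fun [set: measurableTypeR R]
    ((fun x => x + a) : measurableTypeR R -> measurableTypeR R).
  exact: measurable_funD.
pose f : {mfun measurableTypeR R >-> measurableTypeR R} :=
  HB.pack (fun x : measurableTypeR R => (x + a : measurableTypeR R))
    (isMeasurableFun.Build _ _ _ _ _ mf).
transitivity (pushforward mu f A) => //.
apply/esym/lebesgue_measure_unique => //= _ [[b c]] _ <-.
rewrite /pushforward.
rewrite (_ : f @^-1` _ = `](b - a), (c - a)]%classic); last first.
  by apply/seteqP; split=> x /=; rewrite !in_itv/= ltrBlDr lerBrDr.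
rewrite !lebesgue_measure_itv/= !lte_fin ltrD2r -!EFinB.
by rewrite (_ : c - a - (b - a) = c - b)//; ring.
Qed.

(** Uniqueness of the product measure: area may be computed from horizontal sections as well as from
    vertical ones. *)
Lemma area_sections2 E : measurable E -> area E = (mu \x^ mu)%E E.
Proof.
by move=> mE; apply: product_measure_unique => //= *; rewrite product_measure2E.
Qed.

Lemma area_eq_xsection E F :
  (forall x, mu (xsection E x) = mu (xsection F x)) -> area E = area F.
Proof. by move=> EF; apply: eq_integral => x _; exact: EF. Qed.

Lemma area_eq_ysection E F : measurable E -> measurable F ->
  (forall y, mu (ysection E y) = mu (ysection F y)) -> area E = area F.
Proof.
by move=> mE mF EF; rewrite !area_sections2//; apply: eq_integral => x _; exact: EF.
Qed.

Lemma measurable_preimage_pair (f : R * R -> R * R) :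
  measurable_fun setT (fst \o f) -> measurable_fun setT (snd \o f) ->
  forall E, measurable E -> measurable (f @^-1` E).
Proof.
move=> f1 f2 E mE.
have /(_ measurableT _ mE) := measurable_fun_pair f1 f2; rewrite setTI.
by congr (measurable _); apply/funext => w /=; rewrite -surjective_pairing.
Qed.

(** Each vertical section is merely translated, by an amount depending on its abscissa. The offset
    [b] makes translations a special case. *)
Lemma area_vshear (a b : R) E : measurable E ->
  area ((fun w => (w.1, w.2 + (a * w.1 + b))) @^-1` E) = area E.
Proof.
move=> mE; apply: area_eq_xsection => x.
rewrite -(lebesgue_measure_translate (a * x + b) (xsection E x)).
  by congr (mu _); apply/seteqP; split => y; rewrite /xsection/= !inE.
exact: measurable_xsection.
Qed.

Lemma area_hshear (a b : R) E : measurable E ->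
  area ((fun w => (w.1 + (a * w.2 + b), w.2)) @^-1` E) = area E.
Proof.
move=> mE; apply: area_eq_ysection => //.
  apply: measurable_preimage_pair mE => /=.
    by apply: measurable_funD => //; apply: measurable_funD => //; apply: measurable_funM.
  exact: measurable_snd.
move=> y.
rewrite -(lebesgue_measure_translate (a * y + b) (ysection E y)).
  by congr (mu _); apply/seteqP; split => x; rewrite /ysection/= !inE.
exact: measurable_ysection.
Qed.

Lemma measurable_vshear (a b : R) E : measurable E ->
  measurable ((fun w => (w.1, w.2 + (a * w.1 + b))) @^-1` E).
Proof.
move=> mE; apply: measurable_preimage_pair mE => /=; first exact: measurable_fst.
by apply: measurable_funD => //; apply: measurable_funD => //; apply: measurable_funM.
Qed.

Lemma measurable_hshear (a b : R) E : measurable E ->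
  measurable ((fun w => (w.1 + (a * w.2 + b), w.2)) @^-1` E).
Proof.
move=> mE; apply: measurable_preimage_pair mE => /=; last exact: measurable_snd.
by apply: measurable_funD => //; apply: measurable_funD => //; apply: measurable_funM.
Qed.

Lemma area_translate (p : R * R) E : measurable E ->
  area ((fun w => w + p) @^-1` E) = area E.
Proof.
move=> mE.
(* A translation is the composite of two shears of slope 0. *)
rewrite -[RHS](area_vshear 0 p.2)// -[RHS](area_hshear 0 p.1).
  congr (area _); apply/seteqP; split => w /=.
    by rewrite !mul0r !add0r.
  by rewrite !mul0r !add0r.
exact: measurable_vshear.
Qed.

(* A rotation of angle t is a product of three shears, of parameters
   - tan (t/2), sin t, - tan (t/2). *)
Lemma area_rotation (c s : R) E : c ^+ 2 + s ^+ 2 = 1 -> -1 < c ->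
  measurable E ->
  area ((fun w => (c * w.1 - s * w.2, s * w.1 + c * w.2)) @^-1` E) = area E.
Proof.
move=> cs c1 mE.
have c0 : 1 + c != 0 by lra.
pose t := - s / (1 + c).
have m1 := measurable_hshear t 0 E mE.
have m2 := measurable_vshear s 0 _ m1.
rewrite -[RHS](area_hshear t 0)// -[RHS](area_vshear s 0)// -[RHS](area_hshear t 0)//.
(* This is $s^2 = (1 - c)(1 + c)$ divided by $1 + c$. Together with [tc] it turns the product of the
   three shears into the rotation matrix. *)
have st : s * t = c - 1.
  have -> : c - 1 = - s ^+ 2 / (1 + c).
    by rewrite -[LHS](mulfK c0); congr (_ / _); nra.
  by rewrite /t; ring.
have tc : t * (1 + c) = - s by rewrite /t mulfVK.
congr (area _); apply/funext => -[x y] /=; rewrite !addr0.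
have e : y + s * (x + t * y) = s * x + c * y.
  by rewrite mulrDr mulrA st; ring.
rewrite e; congr (E (_, _)).
transitivity ((1 + s * t) * x + (t * (1 + c)) * y); last by ring.
by rewrite st tc; ring.
Qed.

End PlaneMeasure.

(** * Areas of lenses, the intersections of two discs of equal radius *)

Section Lens.
Variable R : realType.
Local Notation mu := (@lebesgue_measure R).
Local Notation area := ((@lebesgue_measure R \x @lebesgue_measure R)%E).

Definition disc (p : R * R) (r : R) : set (R * R) :=
  [set w | (w.1 - p.1) ^+ 2 + (w.2 - p.2) ^+ 2 < r ^+ 2].

(** The function $L(d, r)$, taken in normal position; [area_lens] brings any two discs of equal
    radius to this position. *)
Definition lens (d r : R) : R := fine (area (disc (0, 0) r `&` disc (d, 0) r)).

Lemma measurable_disc p r : measurable (disc p r).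
Proof.
pose f (w : R * R) : R := (w.1 - p.1) ^+ 2 + (w.2 - p.2) ^+ 2.
have mf : measurable_fun setT f.
  by apply: measurable_funD; apply: measurable_funX; apply: measurable_funB.
have /(_ measurableT `]-oo, r ^+ 2[%classic) := mf; rewrite setTI.
rewrite (_ : f @^-1` _ = disc p r); first by apply; exact: measurable_itv.
by apply/seteqP; split => w; rewrite /disc/= in_itv.
Qed.

Lemma measurable_discI p q r : measurable (disc p r `&` disc q r).
Proof. by apply: measurableI; exact: measurable_disc. Qed.

Lemma le_area (E F : set (R * R)) : measurable E -> measurable F ->
  E `<=` F -> (area E <= area F)%E.
Proof. by move=> mE mF EF; apply: le_measure => //; rewrite inE. Qed.

Lemma area_rectangle (a b : R) : 0 <= a -> 0 <= b ->
  area (`]- a, a[ `*` `]- b, b[)%classic = (4 * a * b)%:E.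
Proof.
move=> a0 b0; rewrite product_measure1E//=; try exact: measurable_itv.
rewrite !lebesgue_measure_itv/= !lte_fin.
have [ha|ha] := ltP (- a) a; have [hb|hb] := ltP (- b) b.
- by rewrite -!EFinB -EFinM; congr (_%:E); ring.
- by rewrite mule0 (_ : b = 0) ?mulr0//; lra.
- by rewrite mul0e (_ : a = 0) ?mulr0 ?mul0r//; lra.
- by rewrite mule0 (_ : b = 0) ?mulr0//; lra.
Qed.

(** The lens lies in the square of half-side [r], so its area is finite and [fine] loses nothing. *)
Lemma lensE (d r : R) : 0 <= r ->
  area (disc (0, 0) r `&` disc (d, 0) r) = (lens d r)%:E.
Proof.
move=> r0; rewrite /lens fineK// ge0_fin_numE//.
apply: (@le_lt_trans _ _ (area (`]- r, r[ `*` `]- r, r[)%classic)).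
  apply: le_area; first exact: measurable_discI.
    by apply: measurableX; exact: measurable_itv.
  move=> [x y] [/= + _]; rewrite /disc/= !subr0 => xy.
  by split; rewrite /= in_itv/=; apply/andP; split; nra.
by rewrite area_rectangle// ltry.
Qed.

Lemma lens_ge0 d r : 0 <= lens d r.
Proof. by rewrite fine_ge0. Qed.

Lemma lens_le d r : 0 <= r -> lens d r <= lens 0 r.
Proof.
move=> r0; rewrite -lee_fin -!lensE//.
apply: le_area; try exact: measurable_discI.
by move=> w [].
Qed.

Lemma lens_eq0 d r : 0 <= r -> 2 * r <= d -> lens d r = 0.
Proof.
move=> r0 rd; rewrite /lens (_ : _ `&` _ = set0) ?measure0//.
apply/seteqP; split => // -[x y] [/=]; rewrite /disc/= !subr0 => h1 h2.
have : x < r by nra.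
have : - r < x - d by nra.
lra.
Qed.

(* The constant is the area of the rectangle of half-sides 3r/5 and 4r/5, whose
   vertices lie on the circle. *)
Lemma lens0_ge r : 0 < r -> 48 / 25 * r ^+ 2 <= lens 0 r.
Proof.
move=> r0; rewrite -lee_fin -lensE; last exact: ltW.
rewrite setIid.
have -> : (48 / 25 * r ^+ 2)%:E =
    area (`]- (3 / 5 * r), 3 / 5 * r[ `*` `]- (4 / 5 * r), 4 / 5 * r[)%classic.
  by rewrite area_rectangle; [congr (_%:E); field|lra|lra].
apply: le_area; last 1 first.
- move=> [x y] [] /=; rewrite !in_itv/= => /andP[? ?] /andP[? ?].
  rewrite /disc/= !subr0.
  have : x ^+ 2 < (3 / 5 * r) ^+ 2 by nra.
  have : y ^+ 2 < (4 / 5 * r) ^+ 2 by nra.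
  have -> : r ^+ 2 = (3 / 5 * r) ^+ 2 + (4 / 5 * r) ^+ 2 by field.
  by move=> hy hx; exact: ltrD.
- by apply: measurableX; exact: measurable_itv.
- exact: measurable_disc.
Qed.

Lemma lens0_gt0 r : 0 < r -> 0 < lens 0 r.
Proof. by move=> r0; apply: lt_le_trans (lens0_ge r r0); nra. Qed.

Lemma enormC (p q : R * R) : enorm (p - q) = enorm (q - p).
Proof. by rewrite /enorm/= -(sqrrN (_ - _)) -[X in _ + X]sqrrN !opprB. Qed.

(** Translate [p] to the origin, then use the rotation that takes [(d, 0)] to [q - p]. *)
Lemma area_lens p q r : area (disc p r `&` disc q r) =
  area (disc (0, 0) r `&` disc (enorm (p - q), 0) r).
Proof.
(* This makes the cosine [c] below nonnegative and so avoids the half turn, excluded in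
   [area_rotation]. *)
wlog pq : p q / p.1 <= q.1 => [hw|].
  have [/hw//|/ltW/hw] := leP p.1 q.1.
  by rewrite setIC enormC.
set d := enorm _.
have d0 : 0 <= d by rewrite sqrtr_ge0.
have dE : d ^+ 2 = (p.1 - q.1) ^+ 2 + (p.2 - q.2) ^+ 2.
  by rewrite sqr_sqrtr// addr_ge0// sqr_ge0.
rewrite -(area_translate R p); last exact: measurable_discI.
have -> : (fun w => w + p) @^-1` (disc p r `&` disc q r) =
    disc (0, 0) r `&` disc (q - p) r.
  apply/seteqP; split => w [] /=; rewrite /disc/= !subr0 => h1 h2; split.
  - by move: h1; congr (_ < _); ring.
  - by move: h2; congr (_ < _); ring.
  - by move: h1; congr (_ < _); ring.
  - by move: h2; congr (_ < _); ring.
have [d00|dn0] := eqVneq d 0.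
  rewrite d00; move/esym/eqP: dE; rewrite d00 expr0n/= paddr_eq0 ?sqr_ge0//.
  rewrite !sqrf_eq0 !subr_eq0 => /andP[/eqP e1 /eqP e2].
  suff -> : q - p = (0, 0) by [].
  by rewrite [q]surjective_pairing -e1 -e2 -surjective_pairing subrr.
have dp : 0 < d by rewrite lt_neqAle eq_sym dn0.
pose c := (q.1 - p.1) / d; pose s := (q.2 - p.2) / d.
have cE : c * d = q.1 - p.1 by rewrite /c divfK.
have sE : s * d = q.2 - p.2 by rewrite /s divfK.
have c0 : 0 <= c by rewrite /c divr_ge0// subr_ge0.
have cs : c ^+ 2 + s ^+ 2 = 1.
  apply: (mulIf (expf_neq0 2 dn0)).
  by rewrite mul1r mulrDl -!exprMn cE sE dE; ring.
rewrite -(area_rotation R c s _ cs)//; last 2 first.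
- by lra.
- exact: measurable_discI.
congr (area _).
(* Rotations preserve the norm. Applied to [w] it handles the disc at the origin, applied to
   [w - (d, 0)] the other one. *)
have ball0 (x y : R) : (c * x - s * y) ^+ 2 + (s * x + c * y) ^+ 2 = x ^+ 2 + y ^+ 2.
  by rewrite -[RHS]mul1r -cs; ring.
apply/seteqP; split => -[x y] []; rewrite /disc/= !subr0 -cE -sE => h1 h2; split.
- by rewrite ball0 in h1.
- rewrite -ball0; move: h2; congr (_ < _); ring.
- by rewrite ball0.
- rewrite -ball0 in h2; move: h2; congr (_ < _); ring.
Qed.

(** At height [y] both discs cut out intervals of the same half-length [h], centered at [d] and
    [d']; the difference fits in an interval of length [|d - d'|]. The indicator records that
    heights beyond [r] contribute nothing. *)
Lemma section_discD_le (d d' r y : R) : 0 <= r ->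
  (mu (ysection (disc (d, 0%R) r `\` disc (d', 0%R) r) y)
    <= (`|d - d'| * \1_(`[- r, r]%classic : set R) y)%:E)%E.
Proof.
move=> r0; set E := ysection _ _.
have mE : measurable E.
  by apply: measurable_ysection; apply: measurableD; exact: measurable_disc.
have [yr|yr] := ltP (y ^+ 2) (r ^+ 2); last first.
  rewrite (_ : E = set0) ?measure0 ?lee_fin ?mulr_ge0//.
  apply/seteqP; split => // x; rewrite /E /ysection/= inE /disc/= subr0.
  by move=> [h _]; have := sqr_ge0 (x - d); lra.
rewrite indicE mem_set ?mulr1; last first.
  by rewrite /= in_itv/=; apply/andP; split; nra.
pose h := Num.sqrt (r ^+ 2 - y ^+ 2).
have h0 : 0 <= h by rewrite sqrtr_ge0.
have hE : h ^+ 2 = r ^+ 2 - y ^+ 2 by rewrite sqr_sqrtr// subr_ge0 ltW.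
have EP x : E x -> `|x - d| < h /\ h <= `|x - d'|.
  rewrite /E /ysection/= inE /disc/= !subr0 => -[h1 /negP]; rewrite -leNgt => h2.
  split.
    rewrite -[h]ger0_norm// -ltr_sqr ?nnegrE// !real_normK ?num_real//; lra.
  rewrite -[h]ger0_norm// -ler_sqr ?nnegrE// !real_normK ?num_real//; lra.
pose i := if d <= d' then `[d - h, d' - h]%classic else `[d' + h, d + h]%classic.
apply: (@le_trans _ _ (mu i)).
  apply: le_measure; rewrite ?inE//.
    by rewrite /i; case: ifP => _; exact: measurable_itv.
  move=> x /EP; rewrite ltr_norml => -[/andP[h1 h2] h3].
  rewrite /i; case: (leP d d') => dd /=; rewrite in_itv/=; move: h3; case: ler0P; lra.
rewrite /i; case: (leP d d') => dd; rewrite lebesgue_measure_itv/= !lte_fin.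
  rewrite distrC ger0_norm ?subr_ge0//; case: ifP => _; rewrite -?EFinB lee_fin; lra.
rewrite gtr0_norm ?subr_gt0//; case: ifP => _; rewrite -?EFinB lee_fin; lra.
Qed.

(** Integrate the bound on sections over the heights in $[-r, r]$. *)
Lemma area_discD_le (d d' r : R) : 0 <= r ->
  (area (disc (d, 0%R) r `\` disc (d', 0%R) r) <= (2 * r * `|d - d'|)%:E)%E.
Proof.
move=> r0.
have mE : measurable (disc (d, 0%R) r `\` disc (d', 0%R) r).
  by apply: measurableD; exact: measurable_disc.
rewrite area_sections2//.
apply: (@le_trans _ _ (\int[mu]_y (`|d - d'| * \1_(`[- r, r]%classic : set R) y)%:E)%E).
  apply: ge0_le_integral => //.
  - exact: measurable_fun_ysection.
  - by apply/measurable_EFinP; apply: measurable_funM.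
  - by move=> y _ /=; exact: section_discD_le.
under eq_integral do rewrite EFinM.
rewrite ge0_integralZl//; last first.
- by apply/measurable_EFinP.
rewrite integral_indic//= setIT lebesgue_measure_itv/= lte_fin.
case: ifP => _; rewrite ?mule0 ?lee_fin ?mulr_ge0//.
by lra.
Qed.

Lemma lens_lipschitz d d' r : 0 <= r -> lens d r <= lens d' r + 2 * r * `|d - d'|.
Proof.
move=> r0; rewrite -lee_fin EFinD -!lensE//.
apply: le_trans (leeD2l _ (area_discD_le d d' r r0)).
apply: (@le_trans _ _ (area ((disc (0, 0) r `&` disc (d', 0) r) `|`
    (disc (d, 0%R) r `\` disc (d', 0%R) r)))).
  apply: le_area; first exact: measurable_discI.
    apply: measurableU; first exact: measurable_discI.
    by apply: measurableD; exact: measurable_disc.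
  move=> w [h1 h2]; have [h3|h3] := pselect (disc (d', 0) r w); first by left.
  by right.
apply: measureU2; first exact: measurable_discI.
by apply: measurableD; exact: measurable_disc.
Qed.

End Lens.

(** * Distance, balls and areas on the torus through representatives in the plane *)

Section TorusGeometry.
Variable R : realType.
Local Notation mu := (@lebesgue_measure R).
Local Notation area := ((@lebesgue_measure R \x @lebesgue_measure R)%E).
Implicit Types (p q w : R * R) (x y : torus R) (r : R).

Definition lvec (z : int * int) : R * R := (4 * z.1%:~R, 4 * z.2%:~R).

Lemma mem_lattice4P p : reflect (exists z, p = lvec z) (p \in @lattice4 R).
Proof.
apply: (iffP andP) => [[/intrP[m hm] /intrP[n hn]]|[[m n] ->]].
  exists (m, n); rewrite /lvec/= -hm -hn [LHS]surjective_pairing.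
  by congr (_, _); rewrite mulrC divfK.
by split; rewrite /= mulrC mulKf// intr_int.
Qed.

Lemma torus_projP p q : torus_proj p = torus_proj q <-> exists z, p = q + lvec z.
Proof.
split=> [/eqP|[z ->]].
  rewrite /torus_proj -Quotient.idealrBE => /mem_lattice4P[z e].
  by exists z; rewrite -e addrC subrK.
apply/eqP; rewrite /torus_proj -Quotient.idealrBE.
by apply/mem_lattice4P; exists z; rewrite addrC addKr.
Qed.

Lemma torus_projD p z : torus_proj (p + lvec z) = torus_proj p.
Proof. by apply/torus_projP; exists z. Qed.

Lemma lvecB z z' : lvec z - lvec z' = lvec (z - z').
Proof. by congr (_, _); rewrite /= rmorphB/= mulrBr. Qed.

(** Every half-open square of side 4 is a fundamental domain; the freedom in its corner is used to
    choose representatives close to each other. *)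
Lemma torus_proj_surj (a b : R) x : exists2 p, torus_proj p = x &
  (a <= p.1 < a + 4) && (b <= p.2 < b + 4).
Proof.
pose p := repr x; have px : torus_proj p = x by rewrite /torus_proj reprK.
pose m := Num.floor ((p.1 - a) / 4); pose n := Num.floor ((p.2 - b) / 4).
exists (p + lvec (- (m, n))); first by rewrite torus_projD.
rewrite /= !rmorphN/=.
have := floor_itv ((p.1 - a) / 4); have := floor_itv ((p.2 - b) / 4).
rewrite -/m -/n !rmorphD/=; lra.
Qed.

Lemma int_norm_lt1 (z : int) : `|4 * z%:~R| < (4 : R) -> z = 0.
Proof.
rewrite normrM (@ger0_norm _ 4)// -ltr_pdivlMl// mulVf// -intr_norm.
by rewrite (ltr_int _ _ 1) -[1]add0r ltzD1 normr_le0 => /eqP.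
Qed.

(** A nonzero shift has norm at least 4, hence leaves at least $4 - |t| \ge 2 \ge |t|$. *)
Lemma le_norm_shift (t : R) (z : int) : `|t| <= 2 -> `|t| <= `|t + 4 * z%:~R|.
Proof.
move=> t2; have [->|z0] := eqVneq z 0; first by rewrite mulr0 addr0.
have : (4 : R) <= `|4 * z%:~R|.
  by rewrite leNgt; apply/negP => /int_norm_lt1 e; rewrite e eqxx in z0.
have := ler_normB (t + 4 * z%:~R) t; rewrite addrC addKr.
by lra.
Qed.

Lemma torus_dist_set_lbound x y : has_lbound
  [set enorm (p - q) | p in @torus_proj R @^-1` [set x] & q in @torus_proj R @^-1` [set y]].
Proof. by exists 0 => _ [p _ [q _ <-]]; rewrite sqrtr_ge0. Qed.

Lemma torus_dist_le p q : torus_dist (torus_proj p) (torus_proj q) <= enorm (p - q).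
Proof.
by apply: ge_inf; [exact: torus_dist_set_lbound|exists p => //; exists q].
Qed.

(** By [le_norm_shift] no lattice shift shortens either coordinate of [p - q], so this pair attains
    the infimum. *)
Lemma torus_dist_near p q : `|p.1 - q.1| <= 2 -> `|p.2 - q.2| <= 2 ->
  torus_dist (torus_proj p) (torus_proj q) = enorm (p - q).
Proof.
move=> h1 h2; apply/eqP; rewrite eq_le torus_dist_le/=.
apply: lb_le_inf; first by exists (enorm (p - q)); exists p => //; exists q.
move=> _ [p' /torus_projP[z ->]] [q' /torus_projP[z' ->]] <-.
have -> : p + lvec z - (q + lvec z') = (p - q) + lvec (z - z').
  by rewrite -lvecB opprD addrACA.
have le_sqr_shift (t : R) z0 : `|t| <= 2 -> t ^+ 2 <= (t + 4 * z0%:~R) ^+ 2.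
  move=> t2; rewrite -(real_normK (num_real t)) -[leRHS]real_normK ?num_real//.
  by rewrite lerXn2r ?nnegrE// le_norm_shift.
by rewrite /enorm ler_wsqrtr// lerD// le_sqr_shift.
Qed.

(** An infimum below [r] yields a pair of representatives closer than [r]; shifting both by the same
    lattice vector makes the second one [w]. *)
Lemma torus_ball_preimage p r : 0 < r ->
  @torus_proj R @^-1` torus_ball (torus_proj p) r = \bigcup_z disc R (p + lvec z) r.
Proof.
move=> r0; have enorm_lt (u : R * R) : (enorm u < r) = (u.1 ^+ 2 + u.2 ^+ 2 < r ^+ 2).
  rewrite -ltr_sqr ?nnegrE ?sqrtr_ge0 ?(ltW r0)// sqr_sqrtr//.
  by rewrite addr_ge0 ?sqr_ge0.
apply/seteqP; split => w /=.
  move=> /inf_lt[|_ [p' /torus_projP[z ->]] [q' /torus_projP[z' ->]] <-].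
    by exists (enorm (p - w)); exists p => //; exists w.
  rewrite enorm_lt => h; exists (z - z') => //; rewrite /disc -lvecB.
  by move: h; congr (_ < _) => /=; ring.
move=> [z _]; rewrite /disc => h; rewrite /torus_ball/= -(torus_projD p z).
apply: le_lt_trans (torus_dist_le _ _) _; rewrite enorm_lt.
by move: h; congr (_ < _) => /=; ring.
Qed.

Lemma measurable_torus_ball x r : 0 < r ->
  measurable (@torus_proj R @^-1` torus_ball x r).
Proof.
move=> r0; have [p <- _] := torus_proj_surj 0 0 x.
rewrite torus_ball_preimage//; apply: countable_bigcupT_measurable => [|z].
  exact: countableP.
exact: measurable_disc.
Qed.

(** The piece over $[0, a)$ is cut off and moved by one period to $[4, a + 4)$. *)
Lemma periodic_window (a : R) (A : set R) : measurable A ->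
  (forall t, A (t + 4) <-> A t) -> 0 <= a <= 4 ->
  mu (A `&` `[0, 4[%classic) = mu (A `&` `[a, a + 4[%classic).
Proof.
move=> mA A4 /andP[a0 a4].
have mI (b c : R) : measurable (A `&` `[b, c[%classic : set R).
  by apply: measurableI => //; exact: measurable_itv.
have split_itv (b c d : R) : b <= c <= d ->
    mu (A `&` `[b, d[%classic) =
    (mu (A `&` `[b, c[%classic) + mu (A `&` `[c, d[%classic))%E.
  move=> bcd.
  have U : `[b, d[%classic = (`[b, c[ `|` `[c, d[)%classic :> set R.
    apply/seteqP; split => t /=; rewrite !in_itv/=; last by case; lra.
    by move=> ?; have [?|?] := ltP t c; [left|right]; lra.
  have I0 : (`[b, c[ `&` `[c, d[)%classic = set0 :> set R.
    by apply/seteqP; split=> // t [] /=; rewrite !in_itv/=; lra.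
  rewrite U setIUr measureU; [by []|exact: mI|exact: mI|].
  by rewrite setIACA I0 setI0.
rewrite (split_itv 0 a 4) ?a0// (split_itv a 4 (a + 4)); last lra.
rewrite addeC -(lebesgue_measure_translate R (- 4) (A `&` `[0, a[%classic)); last exact: mI.
congr (_ + mu _)%E; apply/seteqP; split => t /= []; rewrite !in_itv/= => At ?.
  by split; [rewrite -(subrK 4 t); apply/A4|lra].
by split; [apply/A4; rewrite subrK|lra].
Qed.

(** Move the window one coordinate at a time: [periodic_window] on vertical sections, then on
    horizontal ones. *)
Lemma periodic_square (a b : R) (P : set (R * R)) : measurable P ->
  (forall w z, P (w + lvec z) <-> P w) -> 0 <= a <= 4 -> 0 <= b <= 4 ->
  area (P `&` (`[0, 4[ `*` `[0, 4[))%classic =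
  area (P `&` (`[a, a + 4[ `*` `[b, b + 4[))%classic.
Proof.
move=> mP Pz a4 b4.
have mI (c d c' d' : R) : measurable (P `&` (`[c, d[ `*` `[c', d'[))%classic.
  by apply: measurableI => //; apply: measurableX; exact: measurable_itv.
have P1 s t : P (s + 4, t) <-> P (s, t).
  rewrite -(Pz (s, t) (1, 0)) (_ : (s, t) + _ = (s + 4, t))//.
  by congr (_, _); rewrite /= ?mulr1 ?mulr0 ?addr0.
have P2 s t : P (s, t + 4) <-> P (s, t).
  rewrite -(Pz (s, t) (0, 1)) (_ : (s, t) + _ = (s, t + 4))//.
  by congr (_, _); rewrite /= ?mulr1 ?mulr0 ?addr0.
transitivity (area (P `&` (`[0, 4[ `*` `[b, b + 4[))%classic).
  apply: area_eq_xsection => s.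
  have xE (c d : R) : xsection (P `&` (`[0, 4[ `*` `[c, d[))%classic s =
      if s \in `[0, 4[ then xsection P s `&` `[c, d[%classic else set0.
    apply/seteqP; split => t; rewrite /xsection/= inE/=.
      by move=> [? [/= -> ?]]; split => //; rewrite /= inE.
    by case: ifP => // + [/= + ?]; rewrite inE.
  rewrite !xE; case: ifP => // _; apply: periodic_window => //.
    exact: measurable_xsection.
  by move=> t; rewrite /xsection/= !inE.
apply: area_eq_ysection => [||t]; [exact: mI|exact: mI|].
have yE (c d : R) : ysection (P `&` (`[c, d[ `*` `[b, b + 4[))%classic t =
    if t \in `[b, b + 4[ then ysection P t `&` `[c, d[%classic else set0.
  apply/seteqP; split => s; rewrite /ysection/= inE/=.
    by move=> [? [/= ? ->]]; split => //; rewrite /= inE.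
  by case: ifP => // + [/= + ?]; rewrite inE.
rewrite !yE; case: ifP => // _; apply: periodic_window => //.
  exact: measurable_ysection.
by move=> s; rewrite /ysection/= !inE.
Qed.

Lemma disc_norm_lt p w r : 0 < r -> disc R p r w ->
  `|w.1 - p.1| < r /\ `|w.2 - p.2| < r.
Proof.
move=> r0; rewrite /disc/= => h; have := sqr_ge0 (w.1 - p.1).
have := sqr_ge0 (w.2 - p.2) => h1 h2.
by split; rewrite -ltr_sqr ?nnegrE ?(ltW r0)// real_normK ?num_real//; lra.
Qed.

(* Only the fundamental square centered at a representative of x matters: there
   the lifts of the two balls are single discs. *)
Lemma torus_area_ballI x y r : 0 < r <= 1 ->
  torus_area (torus_ball x r `&` torus_ball y r) = (lens R (torus_dist x y) r)%:E.
Proof.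
move=> /andP[r0 r1].
(* Coordinates in $[2, 6)$ put the corner [p - (2, 2)] of the centered square in $[0, 4)^2$, as
   [periodic_square] requires. Then [q] is taken in that square. *)
have [p px pb] := torus_proj_surj 2 2 x.
have [q qy qb] := torus_proj_surj (p.1 - 2) (p.2 - 2) y.
have qp1 : `|p.1 - q.1| <= 2 by rewrite ler_norml; lra.
have qp2 : `|p.2 - q.2| <= 2 by rewrite ler_norml; lra.
rewrite -px -qy torus_dist_near// -lensE; last exact: ltW.
rewrite -area_lens /torus_area preimage_setI.
rewrite (periodic_square (p.1 - 2) (p.2 - 2)); first last.
- by lra.
- by lra.
- by move=> w z; rewrite /= torus_projD.
- by apply: measurableI; exact: measurable_torus_ball.
congr (area _); rewrite !torus_ball_preimage//.
have add0 u : u + lvec (0, 0) = u by rewrite (_ : lvec _ = 0) ?addr0// /lvec /= mulr0.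
apply/seteqP; split => w; last first.
  move=> [hp hq]; split; first by split; exists (0, 0); rewrite ?add0.
  have [] := disc_norm_lt _ _ _ r0 hp; rewrite !ltr_norml => h1 h2.
  by split; rewrite /= in_itv/=; lra.
move=> [[[[m n] _ hp] [[m' n'] _ hq]] [/=]]; rewrite !in_itv/= => w1 w2.
have [] := disc_norm_lt _ _ _ r0 hp; rewrite /= !ltr_norml => hp1 hp2.
(* [w] is within 2 of [p] and within 1 of its shift in each coordinate, so the shift is less than
   3. *)
have m0 : m = 0 by apply: int_norm_lt1; rewrite ltr_norml; lra.
have n0 : n = 0 by apply: int_norm_lt1; rewrite ltr_norml; lra.
subst m n; move: hp hp1 hp2; rewrite mulr0 !addr0 add0 => hp hp1 hp2.
have [] := disc_norm_lt _ _ _ r0 hq; rewrite /= !ltr_norml => hq1 hq2.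
(* Going from [q] to [p], to [w], to the shifted [q] costs less than $2 + 1 + 1 = 4$, strictly
   because the balls are open. *)
have m'0 : m' = 0 by apply: int_norm_lt1; rewrite ltr_norml; lra.
have n'0 : n' = 0 by apply: int_norm_lt1; rewrite ltr_norml; lra.
by move: hq; rewrite m'0 n'0 add0.
Qed.

Lemma torus_dist_refl x : torus_dist x x = 0.
Proof.
have [p <- _] := torus_proj_surj 0 0 x.
rewrite torus_dist_near ?subrr ?normr0// /enorm/= expr0n/= addr0.
by rewrite sqrtr0.
Qed.

Lemma torus_area_ball x r : 0 < r <= 1 ->
  torus_area (torus_ball x r) = (lens R 0 r)%:E.
Proof.
by move=> /(torus_area_ballI x x); rewrite setIid torus_dist_refl.
Qed.

Lemma overlapE x y r : 0 < r <= 1 ->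
  overlap x y r = lens R (torus_dist x y) r / lens R 0 r.
Proof.
by move=> r1; rewrite /overlap (torus_area_ballI x y r r1) (torus_area_ball x r r1).
Qed.

End TorusGeometry.

(** * The covariance series and its deviation from the logarithm *)

Section Covariance.
Variable R : realType.
Variable k : nat.
Hypothesis k_gt0 : (0 < k)%N.
Implicit Types (d r : R).

Local Notation q := (2 ^+ k : R).

Definition overlap_ratio d r : R := lens R d r / lens R 0 r.

Definition ratio_sum (n : nat) d : R :=
  \sum_(0 <= j < n) overlap_ratio d (2 ^- (k * j)).

(** The function $\lambda$ of the theorem. For [d > 0] the series has finitely many nonzero terms,
    so [fine] is harmless there. *)
Definition mbrw_correction d : R :=
  fine ((k%:R * ln 2)%:E * \sum_(0 <= j <oo) (overlap_ratio d (2 ^- (k * j)))%:E)%E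
  + ln d.

Lemma scale_itv (j : nat) : 0 < (2 ^- (k * j) : R) <= 1.
Proof. by rewrite invr_gt0 exprn_gt0//= invf_le1 ?exprn_gt0// exprn_ege1// ler1n. Qed.

Lemma overlap_ratio_ge0 d r : 0 <= overlap_ratio d r.
Proof. by rewrite divr_ge0// lens_ge0. Qed.

Lemma overlap_ratio_le1 d r : 0 < r -> overlap_ratio d r <= 1.
Proof.
by move=> r0; rewrite ler_pdivrMr ?lens0_gt0// mul1r lens_le// ltW.
Qed.

Lemma overlap_ratio_eq0 d r : 0 < r -> 2 * r <= d -> overlap_ratio d r = 0.
Proof. by move=> r0 h; rewrite /overlap_ratio lens_eq0 ?mul0r// ltW. Qed.

(** Moving one center from distance 0 to [d] costs at most $2rd$, and $25/24 = 2 / (48/25)$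
    expresses this as a fraction of the lower bound [lens0_ge]. *)
Lemma overlap_ratio_ge d r : 0 <= d -> 0 < r ->
  1 - 25 / 24 * (d / r) <= overlap_ratio d r.
Proof.
move=> d0 r0; rewrite ler_pdivlMr ?lens0_gt0//.
have := lens_lipschitz R 0 d r (ltW r0); rewrite sub0r normrN ger0_norm// => h.
have h0 := lens0_ge R r r0.
have dr : 0 <= d / r by rewrite divr_ge0// ltW.
have : 25 / 24 * (d / r) * (48 / 25 * r ^+ 2) <= 25 / 24 * (d / r) * lens R 0 r.
  by rewrite ler_wpM2l// mulr_ge0.
have -> : 25 / 24 * (d / r) * (48 / 25 * r ^+ 2) = 2 * r * d.
  by field; rewrite gt_eqF.
move=> h1; rewrite mulrBl mul1r lerBlDr; apply: le_trans h _.
by rewrite lerD2l.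
Qed.

Lemma continuous_overlap_ratio r : 0 < r -> continuous (overlap_ratio ^~ r).
Proof.
move=> r0 d; apply: cvgM; last exact: cvg_cst.
apply/cvgrPdist_le => e e0.
have er : 0 < e / (2 * r) by rewrite divr_gt0// mulr_gt0.
have : \forall t \near d, `|d - t| <= e / (2 * r).
  exact: (cvgr_dist_le (fun t : R => t) d (cvg_id) _ er).
apply: filterS => t; rewrite ler_pdivlMr ?mulr_gt0// => h.
have := lens_lipschitz R d t r (ltW r0).
have := lens_lipschitz R t d r (ltW r0).
rewrite (distrC t d) ler_norml; move: (lens R t r) (lens R d r) => u v h1 h2.
by apply/andP; split; lra.
Qed.

Lemma continuous_ratio_sum n : continuous (ratio_sum n).
Proof.
move=> d; apply: cvg_big => [|j _]; first exact: add_continuous.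
by apply: continuous_overlap_ratio; case/andP: (scale_itv j).
Qed.

Lemma scale_base_ge2 : 2 <= q.
Proof. by rewrite -[X in X <= _]expr1 ler_weXn2l// ler1n. Qed.

Lemma scale_base_gt0 : 0 < q. Proof. by rewrite exprn_gt0. Qed.

(** Take [n] above $2/d$ and use $n \le 2^n \le q^n$. *)
Lemma exists_cutoff d : 0 < d -> exists n, 2 <= d * q ^+ n.
Proof.
move=> d0; exists (Num.truncn (2 / d)).+1.
rewrite mulrC -ler_pdivrMr//; apply: le_trans (ltW (truncnS_gt _)) _.
set n := _.+1; apply: (@le_trans _ _ (2 ^+ n)).
  by rewrite -natrX ler_nat ltnW// ltn_expl.
by rewrite lerXn2r ?nnegrE ?exprn_ge0// scale_base_ge2.
Qed.

Lemma overlap_ratio_cutoff d n j : 2 <= d * q ^+ n -> (n <= j)%N ->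
  0 < d -> overlap_ratio d (2 ^- (k * j)) = 0.
Proof.
move=> dn nj d0; have /andP[s0 _] := scale_itv j.
apply: overlap_ratio_eq0 => //; rewrite ler_pdivrMr ?exprn_gt0// exprM.
apply: le_trans dn _; rewrite ler_wpM2l ?(ltW d0)//.
by rewrite ler_weXn2l//; apply: le_trans scale_base_ge2; rewrite ler1n.
Qed.

(** Any admissible [n] will do: the bound uses the minimal one, continuity a larger one valid near
    [d]. *)
Lemma ratio_series_cutoff d n : 0 < d -> 2 <= d * q ^+ n ->
  (\sum_(0 <= j <oo) (overlap_ratio d (2 ^- (k * j)))%:E)%E = (ratio_sum n d)%:E.
Proof.
move=> d0 dn; rewrite (nneseries_split 0 n); last first.
  by move=> j _; rewrite lee_fin overlap_ratio_ge0.
rewrite !add0n eseries0 ?adde0; last first.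
  by move=> j nj _; rewrite (overlap_ratio_cutoff d n).
by rewrite sumEFin.
Qed.

Lemma mbrw_correctionE d n : 0 < d -> 2 <= d * q ^+ n ->
  mbrw_correction d = k%:R * ln 2 * ratio_sum n d + ln d.
Proof. by move=> d0 dn; rewrite /mbrw_correction (ratio_series_cutoff d n). Qed.

Lemma continuous_mbrw_correction d : 0 < d -> {for d, continuous mbrw_correction}.
Proof.
(* A cutoff for $d/2$ serves every $t > d/2$, so near [d] the correction is one fixed finite sum
   plus [ln]. *)
move=> d0; have [n dn] : exists n, 2 <= (d / 2) * q ^+ n.
  by apply: exists_cutoff; lra.
have E : \forall t \near d, k%:R * ln 2 * ratio_sum n t + ln t = mbrw_correction t.
  have : \forall t \near d, d / 2 < t by apply: (cvgr_gt d (@cvg_id _ _)); lra.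
  apply: filterS => t dt; rewrite -mbrw_correctionE//; first lra.
  by apply: le_trans dn _; rewrite ler_wpM2r ?(ltW dt)// exprn_ge0// ltW// scale_base_gt0.
rewrite /prop_for /continuous_at -(nbhs_singleton E).
apply: cvg_trans; first exact: (near_eq_cvg E).
apply: cvgD; last exact: continuous_ln.
by apply: cvgM; [exact: cvg_cst|exact: continuous_ratio_sum].
Qed.

Lemma ratio_sum_le n d : ratio_sum n d <= n%:R.
Proof.
rewrite /ratio_sum big_mkord -[X in _ <= X%:R]card_ord -sum1_card natr_sum.
by apply: ler_sum => j _; apply: overlap_ratio_le1; case/andP: (scale_itv j).
Qed.

(** The induction closes because $q \ge 2$ gives $2 q^n \le q^{n+1}$. *)
Lemma geometric_sum_le n : \sum_(0 <= j < n.+1) q ^+ j <= 2 * q ^+ n.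
Proof.
elim: n => [|n ih]; first by rewrite big_nat1 expr0; lra.
rewrite big_nat_recr//= exprS; have := scale_base_ge2; have := exprn_gt0 n scale_base_gt0.
nra.
Qed.

(** The losses sum to at most $(25/24) d \cdot 2 q^n$, and $d q^n < 2$ bounds this by $(25/24) \cdot
    4 = 25/6$. *)
Lemma ratio_sum_ge n d : 0 < d -> d * q ^+ n < 2 ->
  n.+1%:R - 25 / 6 <= ratio_sum n.+1 d.
Proof.
move=> d0 dn.
apply: (@le_trans _ _ (\sum_(0 <= j < n.+1) (1 - 25 / 24 * d * q ^+ j))).
  rewrite sumrB -mulr_sumr big_mkord sumr_const card_ord lerD2l lerN2.
  have := geometric_sum_le n; nra.
apply: ler_sum => j _.
have /andP[s0 _] := scale_itv j.
apply: le_trans (overlap_ratio_ge d _ (ltW d0) s0).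
by rewrite invrK exprM mulrA.
Qed.

Lemma ln2_le1 : ln 2 <= 1 :> R.
Proof. by have := @le_ln1Dx R 1; apply; lra. Qed.

Lemma ln2_ge0 : 0 <= ln 2 :> R.
Proof. by rewrite ln_ge0// ler1n. Qed.

Lemma ln_scale d n : 0 < d -> ln (d * q ^+ n) = ln d + k%:R * ln 2 * n%:R.
Proof.
move=> d0; rewrite lnM ?posrE ?exprn_gt0 ?scale_base_gt0//.
by rewrite -exprM lnXn// -[ln 2 *+ _]mulr_natr natrM; congr (_ + _); ring.
Qed.

Lemma mbrw_correction_bound d : 0 < d <= 2 -> `|mbrw_correction d| <= 6 * k%:R.
Proof.
move=> /andP[d0 d2].
have k1 : 1 <= k%:R :> R by rewrite ler1n.
have l0 := ln2_ge0; have l1 := ln2_le1.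
have [n dn n_min] := ex_minnP (exists_cutoff d d0).
rewrite (mbrw_correctionE d n)//.
have lo : ln 2 <= ln d + k%:R * ln 2 * n%:R.
  by rewrite -ln_scale// ler_ln ?posrE// mulr_gt0// exprn_gt0// scale_base_gt0.
case: n => [|n] in dn n_min lo *.
  (* Cutoff 0 leaves an empty sum, and the correction is $\log 2$. *)
  have -> : d = 2 by move: dn; rewrite expr0; lra.
  by rewrite /ratio_sum big_geq// ler_norml; nra.
have dn2 : d * q ^+ n < 2.
  by rewrite ltNge; apply/negP => /n_min; rewrite ltnn.
have hi : ln d + k%:R * ln 2 * n%:R <= ln 2.
  by rewrite -ln_scale// ler_ln ?posrE ?(ltW dn2)// mulr_gt0// exprn_gt0// scale_base_gt0.
have s1 := ratio_sum_le n.+1 d; have s2 := ratio_sum_ge n d d0 dn2.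
have kl0 : 0 <= k%:R * ln 2 :> R by rewrite mulr_ge0.
have kl1 : k%:R * ln 2 <= k%:R :> R by rewrite ler_piMr.
(* With $K = k \log 2$, [hi] and [s1] bound the correction above by $\log 2 + K \le 2k$; [lo] and
   [s2] bound it below by $\log 2 - (25/6) K \ge -(25/6) k$. *)
have := ler_wpM2l kl0 s1; have := ler_wpM2l kl0 s2.
rewrite -natr1 in lo *; rewrite ler_norml => t1 t2; apply/andP; split; lra.
Qed.

Lemma covMBRW_correction (x y : torus R) : 0 < torus_dist x y ->
  covMBRW k x y =
  (ln (1 / torus_dist x y) + mbrw_correction (torus_dist x y))%:E.
Proof.
set d := torus_dist x y => d0.
have [n dn] := exists_cutoff d d0.
(* The term [ln d] of the correction cancels $\log (1/d)$; what remains is the finite sum. *)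
rewrite (mbrw_correctionE d n)// div1r lnV ?posrE// addrC addrK.
rewrite /covMBRW (eq_eseriesr (g := fun j => (overlap_ratio d (2 ^- (k * j)))%:E)).
  by rewrite (ratio_series_cutoff d n).
by move=> j _; rewrite overlapE// scale_itv.
Qed.

End Covariance.

Theorem mainTheorem2 (R : realType) (k : nat) (hk : (1 <= k)%N) :
  exists lambda : R -> R,
    {within `]0, 2], continuous lambda} /\
    (forall r : R, 0 < r <= 2 -> `|lambda r| <= 6 * k%:R) /\
    (forall x y : torus R, 0 < torus_dist x y <= 2 ->
       covMBRW k x y = (ln (1 / torus_dist x y) + lambda (torus_dist x y))%:E).
Proof.
exists (@mbrw_correction R k); split; last split.
- apply: continuous_subspace_itv => d; rewrite in_itv/= => /andP[d0 _].
  exact: continuous_mbrw_correction.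
- by move=> d; exact: mbrw_correction_bound.
- by move=> x y /andP[d0 _]; exact: covMBRW_correction.
Qed.
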